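(* Let $k>2$ and let $sc_k=(k,k-1,\ldots,1)$. For every $S\in SYT(sc_k)$, $\iota(\partial(S))=\partial(\iota(S))$, where $\iota: SYT(sc_k)\to SYT(k^{(k+1)})$ is the embedding defined in the context and $\partial$ denotes promotion (on $SYT(sc_k)$ on the left-hand side and on $SYT(k^{(k+1)})$ on the right-hand side).
   Context: Tableaux are in English notation; box $(i,j)$ is in row $i$ from the top and column $j$ from the left, and $T[i,j]$ is the entry of $T$ in that box. $SYT(\lambda)$ is the set of standard Young tableaux of shape $\lambda$. $c^r$ is the rectangular partition $(c,\ldots,c)$ with $r$ parts, so $k^{(k+1)}$ has $k+1$ rows and $k$ columns. Promotion: for $T\in SYT(\lambda)$ with $|\lambda|=m$, remove the entry $m$ from its box, leaving it empty. Repeatedly move into the empty box the larger of the entries directly north and directly west of it (or the only one present), so the empty box moves to the position of that entry, until the empty box reaches $(1,1)$. This process is called sliding. Then put $0$ in the empty box and add $1$ to every entry. The result is $\partial(T)\in SYT(\lambda)$. Evacuation: for $T\in SYT(\lambda)$ with $|\lambda|=m$, put $T_0=T$, $\lambda_0=\lambda$. For $k=0,1,\ldots,m-1$: in $T_k$ (a filling of the skew shape $\lambda_k$) remove the largest entry, leaving its box empty, and repeatedly move into the empty box the larger of the entries in the boxes of $\lambda_k$ directly north and directly west of it (or the only one present), so the empty box moves to the position of that entry, until no box of $\lambda_k$ lies directly north or west of it; let $(i_k,j_k)$ be its final position. Set $\epsilon(T)[i_k,j_k]=k+1$. Delete box $(i_k,j_k)$ to obtain $\lambda_{k+1}$ and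 $T_{k+1}$. This defines $\epsilon(T)\in SYT(\lambda)$. Embedding $\iota$: for $S\in SYT(sc_k)$ let $N=k(k+1)$. The tableau $R=\iota(S)\in SYT(k^{(k+1)})$ is given, for $1\le i\le k+1$, $1\le j\le k$, by $R[i,j]=S[i,j]$ if $i+j\le k+1$, and $R[i,j]=N+1-\epsilon(S)[k+2-i,\,k+1-j]$ if $i+j>k+1$. *)

(* Defs.v *)
(* MathComp.  Boxes are 1-indexed pairs (row, column) in English notation. *)
From mathcomp Require Import all_boot.
Set Implicit Arguments.
Unset Strict Implicit.
Unset Printing Implicit Defensive.

Definition box := (nat * nat)%type.

(* Only the values on the boxes of the shape under consideration matter. *)
Definition filling := box -> nat.

Definition boxes (la : seq nat) : seq box :=
  [seq (i.+1, j.+1) | i <- iota 0 (size la), j <- iota 0 (nth 0 la i)].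

Definition is_syt (la : seq nat) (T : filling) : Prop :=
  [/\ perm_eq [seq T b | b <- boxes la] (iota 1 (sumn la)),
      forall i j, (i, j) \in boxes la -> (i, j.+1) \in boxes la ->
        T (i, j) < T (i, j.+1)
    & forall i j, (i, j) \in boxes la -> (i.+1, j) \in boxes la ->
        T (i, j) < T (i.+1, j)].

Definition staircase (k : nat) : seq nat := rev (iota 1 k).

Definition rect (c r : nat) : seq nat := nseq r c.

(* These leave the quadrant of positive coordinates, hence every (skew) shape,
   when applied in the first row, resp. the first column. *)
Definition north (b : box) : box := (b.1.-1, b.2).
Definition west (b : box) : box := (b.1, b.2.-1).

Definition pos_of (T : filling) (D : seq box) (v : nat) : box :=
  nth (0, 0) D (find (fun b => T b == v) D).

(* The box of D whose entry moves into the empty box b, if there is one. *)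
Definition slide_source (T : filling) (D : seq box) (b : box) : option box :=
  match north b \in D, west b \in D with
  | true, true => Some (if T (west b) < T (north b) then north b else west b)
  | true, false => Some (north b)
  | false, true => Some (west b)
  | false, false => None
  end.

(* Returns the filling after all moves and the final empty box; the value that
   the filling keeps at that box is junk.  Each move lowers b.1 + b.2 by one, so
   the bound n = b.1 + b.2 used in [slide] is never what stops the process.
   When D is a straight shape, it stops exactly at (1, 1). *)
Fixpoint slide_rec (n : nat) (T : filling) (D : seq box) (b : box) :
    filling * box :=
  if n is n'.+1 then
    if slide_source T D b is Some c
    then slide_rec n' (fun x => if x == b then T c else T x) D c
    else (T, b)
  else (T, b).

Definition slide (T : filling) (D : seq box) (b : box) : filling * box :=
  slide_rec (b.1 + b.2) T D b.

Definition promotion (la : seq nat) (T : filling) : filling :=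
  let: (T', e) := slide T (boxes la) (pos_of T (boxes la) (sumn la)) in
  fun b => (if b == e then 0 else T' b).+1.

(* A state (T_k, la_k) of evacuation: a filling and the boxes of a skew shape. *)
Definition evac_slide (s : filling * seq box) : filling * box :=
  slide s.1 s.2 (pos_of s.1 s.2 (\max_(b <- s.2) s.1 b)).

Definition evac_step (s : filling * seq box) : filling * seq box :=
  let: (T', e) := evac_slide s in (T', [seq b <- s.2 | b != e]).

Definition evac_box (la : seq nat) (T : filling) (k : nat) : box :=
  (evac_slide (iter k evac_step (T, boxes la))).2.

(* The entry is k + 1 at the box deleted in step k, for 0 <= k < |la|. *)
Definition evacuation (la : seq nat) (T : filling) : filling :=
  fun b => (index b [seq evac_box la T k | k <- iota 0 (sumn la)]).+1.

Definition embedding (k : nat) (S : filling) : filling :=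
  fun b => if b.1 + b.2 <= k.+1 then S b
           else (k * k.+1).+1
                - evacuation (staircase k) S (k.+2 - b.1, k.+1 - b.2).

(* Main.v *)
Require Import Defs.
From mathcomp Require Import all_boot zify.
Set Implicit Arguments.
Unset Strict Implicit.
Unset Printing Implicit Defensive.

(** A standard tableau is determined by the word of its boxes, listed by
increasing entry: a linear extension of the shape.  On such words a slide
moves a hole from right to left.  It commutes with a letter unless the
contents (column minus row) of the two differ by one; in that case the empty box
receives the entry of the letter, and the box of the letter becomes the hole
([slide_rec_sweep]).  Promotion sends the last letter through the whole word,
and evacuation repeats this on what remains.

Evacuation can be computed from both ends of the word.  Removing the largest
entry gives [evac_rcons]; adding a letter x on the left lets x pass to the
right through the evacuation of the rest, which is how [evac] is defined.
Together they say that evacuation turns promotion into inverse promotion.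

The word of the embedded tableau is w followed by the half turn of the reversed
word evac w ([embedding_reads]).  Promoting it sends a hole through the half
turned part first.  Up to the half turn this is inverse promotion of evac w,
hence produces evac (promote w), and the hole leaves at the half turn of the
last letter of that word.  It then has to enter w exactly at the last letter h
of w, as the promotion of w itself would ([promote_rect_word]).  This happens
because the last letter of evac (promote w) is the transpose of h
([last_evac_promote_transpose]), which is a form of the Edelman-Greene theorem.

To prove it, let r_0, r_1, ... be the rows of the corners emptied by the steps
of evacuation of w, and let s_r be the transposition of r and r + 1.  The
product of the s_(r_i) is the reversal of 1, ..., k + 1, whatever the tableau
([act_corners_staircase]).  The sequences of w and of promote w agree up to
dropping the first corner h and appending the last letter of
evac (promote w); since conjugation by the reversal sends s_r to s_(k + 1 - r),
the appended corner is the transpose of h.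

That the product does not depend on the tableau is shown with Haiman's
elementary dual equivalences, which exchange two consecutive letters next to a
third one whose content lies strictly between theirs.  Sweeping a hole through
three such letters preserves the relation ([triple_swap_sweep]); once the three
letters are at the end of the word, the exchange alters the sequence of corners
by a commutation or a braid relation ([triple_swap_end]) and has no effect on
the letters to their left ([triple_swap_sweeps]).  All tableaux of one straight
shape are connected by such exchanges ([dual_equiv_straight]), and for the
tableau filled along antidiagonals the product is computed explicitly
([corners_antidiags]). *)

(** * Linear extensions as words of boxes *)

Definition le_box (x y : box) := (x.1 <= y.1) && (x.2 <= y.2).

(** The contents (column minus row) differ by one; stated with sums to avoid
truncated subtraction. *)
Definition adj (x y : box) :=
  (x.2 + y.1 == (y.2 + x.1).+1) || (y.2 + x.1 == (x.2 + y.1).+1).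

(** Convexity makes the letters a skew shape, the kind of shape that remains
during evacuation. *)
Definition linext (w : seq box) :=
  [/\ pairwise (fun x y => ~~ le_box y x) w,
      {in w, forall x, (0 < x.1) && (0 < x.2)}
    & forall x y z, x \in w -> z \in w -> le_box x y -> le_box y z -> y \in w].

Lemma linext_catr p q : linext (p ++ q) -> linext q.
Proof.
case; rewrite pairwise_cat => /and3P[/allrelP H _ H2] P C; split=> //.
  by move=> x xq; apply: P; rewrite mem_cat xq orbT.
move=> x y z xq zq xy yz.
have: y \in p ++ q by apply: C xy yz; rewrite mem_cat ?xq ?zq orbT.
rewrite mem_cat => /orP[yp|//].
by have := H _ _ yp xq; rewrite xy.
Qed.

Lemma linext_catl p q : linext (p ++ q) -> linext p.
Proof.
case; rewrite pairwise_cat => /and3P[/allrelP H H2 _] P C; split=> //.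
  by move=> x xq; apply: P; rewrite mem_cat xq.
move=> x y z xq zq xy yz.
have: y \in p ++ q by apply: C xy yz; rewrite mem_cat ?xq ?zq.
rewrite mem_cat => /orP[//|yp].
by have := H _ _ zq yp; rewrite yz.
Qed.

Lemma le_box_refl x : le_box x x. Proof. by rewrite /le_box !leqnn. Qed.

Lemma linext_uniq w : linext w -> uniq w.
Proof.
case=> H _ _; rewrite uniq_pairwise; apply: sub_pairwise H => x y /= H.
by apply: contraNneq H => ->; exact: le_box_refl.
Qed.

Lemma linext_ext w w' : linext w -> w =i w' ->
   pairwise (fun x y => ~~ le_box y x) w' -> linext w'.
Proof.
case=> _ P C e H; split=> //; first by move=> x; rewrite -e; apply: P.
by move=> x y z; rewrite -!e; apply: C.
Qed.

Lemma linext_before p x q y : linext (p ++ x :: q) ->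
  (y \in q -> ~~ le_box y x) /\ (y \in p -> ~~ le_box x y).
Proof.
case; rewrite pairwise_cat /= => /and4P[/allrelP H _ /allP H2 _] _ _.
by split=> [/H2 //|yp]; apply: H; rewrite ?inE ?eqxx.
Qed.

Lemma linext_rcons u h y : linext (rcons u h) -> y \in u -> ~~ le_box h y.
Proof. by rewrite -cats1 => /(linext_before y)[]. Qed.

Lemma linext_belast u h : linext (rcons u h) -> linext u.
Proof. by rewrite -cats1; apply: linext_catl. Qed.

(** By convexity a box between two letters is itself a letter, and its place in the
word would have to be between two neighbours. *)
Lemma consecutive p x y q z : linext (p ++ x :: y :: q) ->
  le_box x z -> le_box z y -> z = x \/ z = y.
Proof.
move=> L xz zy; have [_ _ C] := L.
have zw : z \in p ++ x :: y :: q.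
  by apply: C xz zy; rewrite mem_cat !inE eqxx ?orbT.
have [_ Hp] := linext_before z L.
have L' : linext ((p ++ [:: x]) ++ y :: q) by rewrite -catA.
have [Hq _] := linext_before z L'.
move: zw; rewrite mem_cat !inE => /or4P[/Hp|/eqP->|/eqP->|/Hq]; auto.
- by rewrite xz.
- by rewrite zy.
Qed.

(** Consecutive letters are comparable only if one covers the other, and then their
contents differ by one. *)
Lemma linext_swap p x y q : linext (p ++ x :: y :: q) -> ~~ adj x y ->
  linext (p ++ y :: x :: q).
Proof.
move=> L nadj; apply: (linext_ext L).
  by move=> z; rewrite !mem_cat !inE; congr (_ || _); rewrite orbCA.
have nxy : ~~ le_box x y.
  apply/negP=> xy.
  have Lu := linext_uniq L.
  have nexy : x <> y.
    by move=> e; move: Lu; rewrite e cat_uniq /= inE eqxx !andbF.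
  move: x y L nadj xy nexy {Lu} => [a b] [c d] L.
  rewrite /adj /le_box /= => nadj /andP[ac bd] ne.
  have [a_c|c_a] := ltnP a c.
    case: (@consecutive _ _ _ _ (a.+1, b) L); rewrite /le_box /=; first by lia.
    - by lia.
    - by case; lia.
    - by case; lia.
  have ? : b < d.
    by rewrite ltn_neqAle bd andbT; apply/eqP=> ?; apply: ne; congr (_, _); lia.
  case: (@consecutive _ _ _ _ (a, b.+1) L); rewrite /le_box /=; first by lia.
  - by lia.
  - by case; lia.
  - by case; lia.
case: L; rewrite !pairwise_cat !allrel_consr /= => /and3P[/and3P[-> -> ->] ->].
by rewrite nxy => /and3P[/andP[_ ->] -> ->] _ _.
Qed.

(** Of two boxes on one diagonal the smaller one is followed, before the larger one
comes, by its neighbours on both adjacent diagonals. *)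
Lemma same_content p x m y q : linext (p ++ x :: m ++ y :: q) ->
  x.2 + y.1 = y.2 + x.1 ->
  ((x.1, x.2.+1) \in m) /\ ((x.1.+1, x.2) \in m).
Proof.
move=> L e.
have L' : linext ((p ++ x :: m) ++ y :: q) by rewrite -catA.
have nyx : ~~ le_box y x.
  have [+ _] := linext_before y L; apply.
  by rewrite mem_cat inE eqxx orbT.
have xw : x \in p ++ x :: m ++ y :: q by rewrite mem_cat inE eqxx orbT.
have yw : y \in p ++ x :: m ++ y :: q.
  by rewrite mem_cat inE mem_cat inE eqxx !orbT.
have key z : le_box x z -> le_box z y -> z != x -> z != y -> z \in m.
  move=> xz zy zx zy'; have [_ _ C] := L.
  have := C _ _ _ xw yw xz zy.
  rewrite mem_cat inE mem_cat inE (negbTE zx) (negbTE zy') /=.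
  have [_ /contraL Hp] := linext_before z L.
  have [/contraL Hq _] := linext_before z L'.
  by rewrite (negbTE (Hp xz)) (negbTE (Hq zy)) orbF.
move: nyx; rewrite /le_box => nyx.
by split; apply: key; rewrite ?/le_box -?pair_eqE /=; lia.
Qed.

(** * Promotion and evacuation of words *)

(** A hole h enters u from the right.  The result consists of the box through which
it leaves on the left and the letters that it leaves behind. *)
Fixpoint sweep (u : seq box) (h : box) : box * seq box :=
  if u is x :: u1 then
    let: (g, u2) := sweep u1 h in
    if adj x g then (x, g :: u2) else (g, x :: u2)
  else (h, [::]).

(** The mirror image of [sweep]: x enters v from the left, and the last letter of
the result is the one that leaves on the right.  On words this is the inverse
of promotion. *)
Fixpoint pass (x : box) (v : seq box) : seq box :=
  if v is y :: v1 then
    if adj x y then x :: pass y v1 else y :: pass x v1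
  else [:: x].

(** The letters are the boxes vacated by the successive slides; the reason is
[evac_rcons]. *)
Fixpoint evac (w : seq box) : seq box :=
  if w is x :: u then pass x (evac u) else [::].

(** The corners emptied by the successive steps of evacuation: the state after each
step is the same for x :: u as for u, with one more letter on its left, so that
only the last step is new. *)
Fixpoint corners (w : seq box) : seq box :=
  if w is x :: u then rcons (corners u) (last x (pass x (evac u))) else [::].

Lemma size_pass x v : size (pass x v) = (size v).+1.
Proof. by elim: v x => //= y v IH x; case: ifP => _ /=; rewrite IH. Qed.

Lemma size_evac w : size (evac w) = size w.
Proof. by elim: w => //= x u IH; rewrite size_pass IH. Qed.

Lemma perm_swap2 (x y : box) s : perm_eq (x :: y :: s) (y :: x :: s).
Proof. by apply/permP => a /=; rewrite addnCA. Qed.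

Lemma perm_pass x v : perm_eq (pass x v) (x :: v).
Proof.
elim: v x => //= y v IH x; case: ifP => _; first by rewrite perm_cons.
by apply: perm_trans (perm_swap2 _ _ _); rewrite perm_cons.
Qed.

Lemma perm_evac w : perm_eq (evac w) w.
Proof.
elim: w => //= x u IH; apply: perm_trans (perm_pass _ _) _.
by rewrite perm_cons.
Qed.

Lemma perm_sweep u h : perm_eq ((sweep u h).1 :: (sweep u h).2) (rcons u h).
Proof.
elim: u => //= x u; case: (sweep u h) => g u2 /= IH.
have e : perm_eq (x :: g :: u2) (x :: rcons u h) by rewrite perm_cons.
case: ifP => _ //=; apply: perm_trans e.
exact: perm_swap2.
Qed.

Lemma size_sweep u h : size (sweep u h).2 = size u.
Proof. by have /perm_size := perm_sweep u h; rewrite /= size_rcons => -[]. Qed.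

Lemma sweep_cat u v h :
  sweep (u ++ v) h =
    ((sweep u (sweep v h).1).1, (sweep u (sweep v h).1).2 ++ (sweep v h).2).
Proof.
elim: u => [|x u IH] /=; first by case: (sweep v h).
rewrite IH; case: (sweep v h) => g v1 /=; case: (sweep u g) => g' u1 /=.
by case: ifP.
Qed.

(** Links the recursion from the left, which defines [evac], to the removal of the
largest entry: sending h through x :: u and then letting what is left of x pass
through the evacuation of the rest gives the same letters in either order. *)
Lemma evac_rcons u h : evac (rcons u h) = (sweep u h).1 :: evac (sweep u h).2.
Proof.
elim: u => //= x u ->; case: (sweep u h) => g u2 /=.
by case: ifP.
Qed.

Lemma last_pass x v z : last z (pass x v) = last x (pass x v).
Proof. by case: v => //= y v; case: ifP. Qed.

Lemma corners_rcons u h : corners (rcons u h) = h :: corners (sweep u h).2.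
Proof.
elim: u => //= x u ->; rewrite evac_rcons; case: (sweep u h) => g u2 /=.
by case: ifP => _ /=; rewrite last_pass.
Qed.

(** Several holes hs, in this order, go through u.  Seen from one letter of u, the
letter passes to the right through the list of holes. *)
Fixpoint sweeps (u hs : seq box) : seq box * seq box :=
  if u is c :: u1 then
    let: (g, u2) := sweeps u1 hs in
    (take (size g) (pass c g), last c (pass c g) :: u2)
  else (hs, [::]).

Lemma pass_split c g : pass c g = rcons (take (size g) (pass c g)) (last c (pass c g)).
Proof.
rewrite -{1}(cat_take_drop (size g) (pass c g)) -cats1; congr (_ ++ _).
have: size (drop (size g) (pass c g)) = 1 by rewrite size_drop size_pass subSnn.
have := cat_take_drop (size g) (pass c g).
case: (drop _ _) => [|a [|]] // <- _.
by rewrite last_cat.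
Qed.

Lemma pass_cat c g v :
  pass c (g ++ v) = take (size g) (pass c g) ++ pass (last c (pass c g)) v.
Proof.
elim: g c => //= y g IH c; case: ifP => _ /=; rewrite IH.
  by rewrite (last_pass y g c).
by rewrite (last_pass c g y).
Qed.

(** Evacuating t first produces the holes evac t, which then go through u. *)
Lemma evac_cat u t :
  evac (u ++ t) = (sweeps u (evac t)).1 ++ evac (sweeps u (evac t)).2.
Proof.
elim: u => [|c u IH] /=; first by rewrite cats0.
by rewrite IH; case: (sweeps u _) => g u2 /=; rewrite pass_cat.
Qed.

Lemma corners_cat u t :
  corners (u ++ t) = corners t ++ corners (sweeps u (evac t)).2.
Proof.
elim: u => [|c u IH] /=; first by rewrite cats0.
rewrite IH evac_cat; case: (sweeps u _) => g u2 /=.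
rewrite rcons_cat pass_cat last_cat; congr (_ ++ rcons _ _).
by rewrite last_pass.
Qed.

Lemma sweeps_rcons u c hs :
  sweeps (rcons u c) hs =
  ((sweeps u (take (size hs) (pass c hs))).1,
   rcons (sweeps u (take (size hs) (pass c hs))).2 (last c (pass c hs))).
Proof.
elim: u => //= x u ->; by case: (sweeps u _).
Qed.

Lemma linext_sweep p u h q : linext (p ++ u ++ h :: q) ->
  linext (p ++ (sweep u h).1 :: (sweep u h).2 ++ q).
Proof.
elim: u p q => //= x u IH p q; rewrite -cat1s catA => /IH.
case: (sweep u h) => g u2 /=; rewrite -catA /= => L.
by case: ifP => /= nxg //; apply: linext_swap; rewrite ?nxg.
Qed.

Lemma linext_pass p x v q : linext (p ++ x :: v ++ q) -> linext (p ++ pass x v ++ q).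
Proof.
elim: v x p => //= y v IH x p; case: ifP => xy L.
  by have := IH y (rcons p x); rewrite !cat_rcons; apply.
have := IH x (rcons p y); rewrite !cat_rcons; apply.
by apply: linext_swap; rewrite ?xy.
Qed.

Lemma linext_evac p w : linext (p ++ w) -> linext (p ++ evac w).
Proof.
elim: w p => //= x u IH p; rewrite -cat_rcons => /IH; rewrite cat_rcons => L.
by have := @linext_pass p x (evac u) [::]; rewrite !cats0; apply.
Qed.

Lemma linext_sweep_behead u h : linext (rcons u h) -> linext (sweep u h).2.
Proof.
rewrite -cats1 => L; have := @linext_sweep [::] u h [::] L.
by rewrite cats0; apply: (@linext_catr [:: _]).
Qed.

(** * Elementary dual equivalences *)

Definition lt_content (x y : box) := x.2 + y.1 < y.2 + x.1.

Definition between (z x y : box) :=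
  (lt_content x z && lt_content z y) || (lt_content y z && lt_content z x).

(** Haiman's elementary dual equivalences: x and y are exchanged beside a witness z
whose content is strictly between those of x and y. *)
Inductive triple_swap : seq box -> seq box -> Prop :=
| Swap_last z x y of between z x y : triple_swap [:: z; x; y] [:: z; y; x]
| Swap_first z x y of between z x y : triple_swap [:: x; y; z] [:: y; x; z].

Lemma triple_swap_sym t t' : triple_swap t t' -> triple_swap t' t.
Proof.
case=> z x y; rewrite /between orbC => b.
  by apply: Swap_last.
by apply: Swap_first.
Qed.

Lemma triple_swap_perm t t' : triple_swap t t' -> perm_eq t t'.
Proof.
case=> z x y _; first by rewrite perm_cons perm_swap2.
exact: perm_swap2.
Qed.

Lemma triple_swap_size t t' : triple_swap t t' -> size t = 3.
Proof. by case. Qed.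

Lemma linext_triple_swap p t t' q : triple_swap t t' ->
  linext (p ++ t ++ q) -> linext (p ++ t' ++ q).
Proof.
case=> z x y; rewrite /between /lt_content => B L.
  rewrite /= -cat_rcons; apply: linext_swap; first by rewrite cat_rcons.
  by rewrite /adj; lia.
by apply: linext_swap; rewrite // /adj; lia.
Qed.

Definition neq_content (a b : box) := a.2 + b.1 != b.2 + a.1.

(** Among four consecutive letters only the first and the last can have the same
content, and then the two others are their neighbours on both sides. *)
Lemma linext4_neq_content a b c h : linext [:: a; b; c; h] ->
  [/\ neq_content a b, neq_content b c, neq_content c h, neq_content a c
   & neq_content b h && (neq_content a h || (adj a b && adj a c && between a b c)) ].
Proof.
move=> L.
have d12 p x y q : linext (p ++ x :: [::] ++ y :: q) -> neq_content x y.
  by move=> L'; apply/eqP=> /(same_content L') [].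
have d13 p x z y q : linext (p ++ x :: [:: z] ++ y :: q) -> neq_content x y.
  move=> L'; apply/eqP=> /(same_content L').
  by rewrite !inE => -[/eqP<- /eqP []]; lia.
split.
- exact: (d12 [::] a b [:: c; h]).
- exact: (d12 [:: a] b c [:: h]).
- exact: (d12 [:: a; b] c h [::]).
- exact: (d13 [::] a b c [:: h]).
rewrite (d13 [:: a] b c h [::]) //=.
case: (boolP (neq_content a h)) => //= /negbNE/eqP e.
have := @same_content [::] a [:: b; c] h [::] L e; rewrite !inE => -[].
rewrite /adj /between /lt_content.
by move=> /orP[] /eqP<- /orP[] /eqP; [case|move=> <-|move=> <-|case] => /=; lia.
Qed.

Ltac decide_adj :=
  repeat (let H := fresh in
          case: ifP; rewrite /adj /= => H; try (exfalso; lia)).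

Ltac decide_swap :=
  first [ apply: Swap_last; rewrite /between /lt_content; lia
        | apply: Swap_first; rewrite /between /lt_content; lia ].

(** A finite check on the contents of the four letters.  Where the hole stops, the
exchanged pair or its witness can change; the configurations in which the
relation would get lost are those that [linext4_neq_content] excludes, such as
a hole with the content of z when x and y are not both adjacent to z. *)
Lemma triple_swap_sweep t t' h : linext (rcons t h) -> linext (rcons t' h) ->
  triple_swap t t' ->
  (sweep t h).1 = (sweep t' h).1 /\ triple_swap (sweep t h).2 (sweep t' h).2.
Proof.
move=> L L' E; case: E L L' => z x y /= B.
all: move=> /linext4_neq_content[A1 A2 A3 A4 A5] /linext4_neq_content[B1 B2 B3 B4 B5].
all: move: B A1 A2 A3 A4 A5 B1 B2 B3 B4 B5.
all: rewrite /neq_content /adj /between /lt_content => B A1 A2 A3 A4 A5 B1 B2 B3 B4 B5.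
all: decide_adj; split=> //; decide_swap.
Qed.

(** The mirror image of [triple_swap_sweep]. *)
Lemma triple_swap_pass t t' c : linext (c :: t) -> linext (c :: t') ->
  triple_swap t t' ->
  last c (pass c t) = last c (pass c t') /\
  triple_swap (take 3 (pass c t)) (take 3 (pass c t')).
Proof.
move=> L L' E; case: E L L' => z x y /= B.
all: move=> /linext4_neq_content[A1 A2 A3 A4 A5] /linext4_neq_content[B1 B2 B3 B4 B5].
all: move: B A1 A2 A3 A4 A5 B1 B2 B3 B4 B5.
all: rewrite /neq_content /adj /between /lt_content => B A1 A2 A3 A4 A5 B1 B2 B3 B4 B5.
all: decide_adj; split=> //; decide_swap.
Qed.

(** Each letter of p passes through the three holes, and by [triple_swap_pass] it
does not see the difference between hs and hs'. *)
Lemma triple_swap_sweeps p hs hs' : linext (p ++ hs) -> linext (p ++ hs') ->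
  triple_swap hs hs' -> (sweeps p hs).2 = (sweeps p hs').2.
Proof.
elim/last_ind: p hs hs' => // p c IH hs hs'; rewrite !cat_rcons => L L' E.
have [e E1] := triple_swap_pass (linext_catr L) (linext_catr L') E.
have sz := triple_swap_size E; have sz' := triple_swap_size (triple_swap_sym E).
have key v : linext (p ++ c :: v) -> linext (p ++ take (size v) (pass c v)).
  have := @linext_pass p c v [::]; rewrite !cats0 => H /H.
  by rewrite {1}pass_split -cats1 catA; apply: linext_catl.
rewrite !sweeps_rcons /= sz sz' e; congr rcons.
by apply: IH E1; [move: (key _ L)|move: (key _ L')]; rewrite ?sz ?sz'.
Qed.

(** * Corners of the staircase and adjacent transpositions *)

(** What remains of the staircase of size k at any stage of evacuation.  It makes
the last letter, which is the next corner to be emptied, a box of the border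
i + j = k + 1. *)
Definition to_border (k : nat) (w : seq box) :=
  {in w, forall x, x.1 + x.2 <= k.+1 /\
     (x.1 + x.2 <= k -> ((x.1.+1, x.2) \in w) /\ ((x.1, x.2.+1) \in w))}.

Lemma to_border_ext k w w' : to_border k w -> w =i w' -> to_border k w'.
Proof. by move=> H e x; rewrite -!e; apply: H. Qed.

Lemma to_border_catr k p q : linext (p ++ q) -> to_border k (p ++ q) -> to_border k q.
Proof.
move=> [L _ _] H x xq; have [|H1 H2] := H x; first by rewrite mem_cat xq orbT.
have up y : le_box x y -> y \in p ++ q -> y \in q.
  move: L; rewrite pairwise_cat mem_cat => /and3P[/allrelP L _ _] xy /orP[yp|//].
  by have := L _ _ yp xq; rewrite xy.
by split=> // /H2[? ?]; split; apply: up; rewrite // /le_box /= leqnn leqnSn.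
Qed.

Lemma to_border_sweep k u h : linext (rcons u h) -> to_border k (rcons u h) ->
  to_border k (sweep u h).2.
Proof.
rewrite -cats1 => L; have := @linext_sweep [::] u h [::] L.
rewrite cats0 => /(@to_border_catr k [:: _]) L' O; apply: L'.
by apply: (to_border_ext O) => z; rewrite cats1 -(perm_mem (perm_sweep u h)).
Qed.

Lemma to_border_last k u h : linext (rcons u h) -> to_border k (rcons u h) ->
  h.1 + h.2 = k.+1.
Proof.
move=> L O; have hin : h \in rcons u h by rewrite mem_rcons inE eqxx.
have [le_k up] := O _ hin; apply/eqP; rewrite eqn_leq le_k /= ltnNge.
apply/negP=> /up[+ _]; rewrite mem_rcons inE -pair_eqE /= gtn_eqF //= => ru.
rewrite -cats1 in L; have [_ /(_ ru)] := linext_before (h.1.+1, h.2) L.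
by rewrite /le_box /= leqnSn leqnn.
Qed.

Lemma to_border_penultimate k p x y : linext (p ++ [:: x; y]) ->
  to_border k (p ++ [:: x; y]) -> x.1 + x.2 = k.+1.
Proof.
move=> L /(to_border_catr L) O; have [|xk up] := O x; first by rewrite inE eqxx.
apply/eqP; rewrite eqn_leq xk ltnNge /=; apply/negP => /up.
by rewrite !inE -!pair_eqE /=; lia.
Qed.

Lemma corners_on_border k w : linext w -> to_border k w ->
  all (fun x => x.1 + x.2 == k.+1) (corners w).
Proof.
have [n] := ubnP (size w); elim: n w => // n IH w.
case/lastP: w => // u h; rewrite size_rcons ltnS => sz L O.
rewrite corners_rcons /= (to_border_last L O) eqxx /=.
apply: IH; [by rewrite size_sweep|exact: linext_sweep_behead|exact: to_border_sweep].
Qed.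

Definition swap_at (r x : nat) := if x == r then r.+1 else if x == r.+1 then r else x.

Definition act (rs : seq nat) (x : nat) := foldl (fun x r => swap_at r x) x rs.

Lemma act_cat rs rs' x : act (rs ++ rs') x = act rs' (act rs x).
Proof. exact: foldl_cat. Qed.

Lemma swap_at_spec r x :
  (x = r /\ swap_at r x = r.+1) \/ (x = r.+1 /\ swap_at r x = r) \/
  (x <> r /\ x <> r.+1 /\ swap_at r x = x).
Proof. by rewrite /swap_at; case: eqP => ?; [|case: eqP => ?]; auto. Qed.

Lemma swap_at_comm r r' x : (r.+1 < r') || (r'.+1 < r) ->
  swap_at r (swap_at r' x) = swap_at r' (swap_at r x).
Proof.
move: (@swap_at_spec r x) (@swap_at_spec r' x).
move: (@swap_at_spec r (swap_at r' x)) (@swap_at_spec r' (swap_at r x)).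
lia.
Qed.

Lemma swap_at_braid r x :
  swap_at r (swap_at r.+1 (swap_at r x)) = swap_at r.+1 (swap_at r (swap_at r.+1 x)).
Proof.
move: (@swap_at_spec r x) (@swap_at_spec r.+1 x).
move: (@swap_at_spec r.+1 (swap_at r x)) (@swap_at_spec r (swap_at r.+1 x)).
move: (@swap_at_spec r (swap_at r.+1 (swap_at r x))).
move: (@swap_at_spec r.+1 (swap_at r (swap_at r.+1 x))).
lia.
Qed.

(** On the border all contents have the same parity.  So if all three letters are
on it, the exchange of x and y is a commutation; otherwise z is the box covered
by two neighbouring corners x and y, which gives a braid relation. *)
Lemma triple_swap_end k t t' : linext t -> linext t' -> to_border k t ->
  triple_swap t t' ->
  triple_swap (evac t) (evac t') /\
  act [seq b.1 | b <- corners t] =1 act [seq b.1 | b <- corners t'].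
Proof.
move=> L L' O E; case: E L L' O => z x y B Lxy Lyx O.
  have Ey : y.1 + y.2 = k.+1 by apply: (to_border_last (u := [:: z; x]) Lxy O).
  have Ex : x.1 + x.2 = k.+1.
    apply: (@to_border_last k [:: z; y] x Lyx); apply: (to_border_ext O) => b.
    by rewrite !inE; congr (_ || _); rewrite orbC.
  have [|] := O z; first by rewrite inE eqxx.
  rewrite leq_eqVlt => /orP[/eqP Ez _|zk /(_ zk)[]].
    move: B; rewrite /between /lt_content => B /=.
    decide_adj.
    split; first by apply: Swap_first; rewrite /between /lt_content; lia.
    by move=> c; rewrite /act /= (@swap_at_comm x.1 y.1) //; lia.
  rewrite !inE -!pair_eqE /= => I1 I2.
  move: B; rewrite /between /lt_content => B.
  decide_adj.
  split; first by apply: Swap_last; rewrite /between /lt_content; lia.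
  move=> c; rewrite /act /=.
  have [->|->] : x.1 = y.1.+1 \/ y.1 = x.1.+1 by lia.
    by rewrite swap_at_braid.
  by rewrite swap_at_braid.
have O' : to_border k [:: y; x; z] by apply: (to_border_ext O) => b; rewrite !inE orbCA.
have Ez : z.1 + z.2 = k.+1 by apply: (to_border_last (u := [:: x; y]) Lxy O).
have Ey : y.1 + y.2 = k.+1 by apply: (@to_border_penultimate k [:: x] y z).
have Ex : x.1 + x.2 = k.+1 by apply: (@to_border_penultimate k [:: y] x z).
move: B; rewrite /between /lt_content => B /=.
decide_adj.
split; first by apply: Swap_last; rewrite /between /lt_content; lia.
by move=> c; rewrite /act /= (@swap_at_comm x.1 y.1) //; lia.
Qed.

(** A hole entering from the right meets q first and preserves the relation between
t and t' by [triple_swap_sweep].  When q is used up, [triple_swap_end] compares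
the next three corners, and [triple_swap_sweeps] shows that all later ones agree. *)
Lemma act_corners_triple_swap k p t t' q : triple_swap t t' ->
  linext (p ++ t ++ q) -> to_border k (p ++ t ++ q) ->
  act [seq b.1 | b <- corners (p ++ t ++ q)] =1
  act [seq b.1 | b <- corners (p ++ t' ++ q)].
Proof.
have [n] := ubnP (size q); elim: n p t t' q => // n IH p t t'.
case/lastP=> [_ | q h]; last rewrite size_rcons ltnS => sz.
  rewrite !cats0 => E L O.
  have L' : linext (p ++ t').
    by have := @linext_triple_swap p t t' [::] E; rewrite !cats0; apply.
  have [Ee Ea] :=
    triple_swap_end (linext_catr L) (linext_catr L') (to_border_catr L O) E.
  have := triple_swap_sweeps (linext_evac L) (linext_evac L') Ee.
  by move=> e x; rewrite !corners_cat !map_cat !act_cat Ea e.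
move=> E; rewrite -!rcons_cat => L O.
have L' : linext (rcons (p ++ t' ++ q) h).
  by move: L; rewrite -!cats1 -!catA; apply: linext_triple_swap.
have L1 := linext_sweep_behead L; have O1 := to_border_sweep L O.
move=> x; rewrite !corners_rcons /= .
move: L1 O1; rewrite !sweep_cat /=; set g := (sweep q h).1; set q' := (sweep q h).2.
have key s : linext (rcons (p ++ s ++ q) h) -> linext (rcons s g).
  rewrite -cats1 -!catA => /linext_catr.
  move=> /(@linext_sweep s q h [::]).
  by rewrite -cat_rcons => /linext_catl.
have [eg E1] := triple_swap_sweep (key _ L) (key _ L') E.
rewrite eg => L1 O1.
by rewrite /act /=; apply: (IH _ _ _ q' _ E1 L1 O1); rewrite size_sweep.
Qed.

(** * Connectedness of the tableaux of a straight shape *)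

Inductive dual_equiv : seq box -> seq box -> Prop :=
| Dual_refl w : dual_equiv w w
| Dual_step p t t' q w of triple_swap t t' & dual_equiv (p ++ t' ++ q) w :
    dual_equiv (p ++ t ++ q) w.

Lemma dual_equiv_trans w1 w2 w3 :
  dual_equiv w1 w2 -> dual_equiv w2 w3 -> dual_equiv w1 w3.
Proof.
by move=> E; elim: E w3 => // p t t' q w E _ IH w3 /IH; apply: Dual_step.
Qed.

Lemma dual_equiv_rcons w w' c : dual_equiv w w' -> dual_equiv (rcons w c) (rcons w' c).
Proof.
elim=> [u|p t t' q u E _]; first exact: Dual_refl.
by rewrite !rcons_cat; apply: Dual_step E.
Qed.

Lemma dual_equiv_linext w w' : dual_equiv w w' -> linext w ->
  linext w' /\ perm_eq w w'.
Proof.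
elim=> [u|p t t' q u E _ IH L]; first by split.
have [Lu pu] := IH (linext_triple_swap E L); split=> //; apply: perm_trans pu.
by rewrite perm_cat2l perm_cat2r triple_swap_perm.
Qed.

Lemma act_corners_dual_equiv k w w' : dual_equiv w w' -> linext w -> to_border k w ->
  act [seq b.1 | b <- corners w] =1 act [seq b.1 | b <- corners w'].
Proof.
elim=> // p t t' q u E _ IH L O x; rewrite (act_corners_triple_swap E L O) IH //.
  exact: linext_triple_swap E L.
apply: (to_border_ext O) => z.
by rewrite !mem_cat (perm_mem (triple_swap_perm E)).
Qed.

Definition straight (w : seq box) :=
  forall x y, y \in w -> 0 < x.1 -> 0 < x.2 -> le_box x y -> x \in w.

Lemma straight_ext w w' : straight w -> w =i w' -> straight w'.
Proof. by move=> S e x y; rewrite -!e; apply: S. Qed.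

Lemma straight_rcons u h : linext (rcons u h) -> straight (rcons u h) -> straight u.
Proof.
move=> L S x y yu x1 x2 xy.
have := S x y _ x1 x2 xy; rewrite !mem_rcons !inE yu orbT => /(_ isT)/orP[/eqP e|//].
by have := linext_rcons L yu; rewrite -e xy.
Qed.

(** A maximal letter z of v among those that dominate the meet of c and c0 will do:
preceding c and c0, it dominates neither of them, so its content is strictly
between theirs. *)
Lemma exists_maximal_between v c c0 : linext (rcons (rcons v c) c0) ->
  straight (rcons (rcons v c) c0) -> ~~ le_box c c0 ->
  exists z, [/\ z \in v, forall y, y \in v -> le_box z y -> y = z & between z c c0].
Proof.
move=> L S ncc0; have L1 := linext_belast L.
have nc0c : ~~ le_box c0 c by apply: (linext_rcons L); rewrite mem_rcons inE eqxx.
have [_ pos _] := L.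
have /pos posc : c \in rcons (rcons v c) c0.
  by rewrite mem_rcons inE mem_rcons inE eqxx orbT.
have c0w : c0 \in rcons (rcons v c) c0 by rewrite mem_rcons inE eqxx.
have posc0 := pos _ c0w.
set m : box := (minn c.1 c0.1, minn c.2 c0.2).
have mv : m \in v.
  have : m \in rcons (rcons v c) c0.
    by apply: (S _ c0 c0w); rewrite /le_box /=; lia.
  rewrite mem_rcons inE mem_rcons inE => /or3P[/eqP e|/eqP e|//].
    by move: nc0c; rewrite -e /le_box /=; lia.
  by move: ncc0; rewrite -e /le_box /=; lia.
have : m \in filter (le_box m) v by rewrite mem_filter le_box_refl.
have L2 := linext_belast L1; have [+ _ _] := L2.
move=> /(pairwise_filter (le_box m)).
(* The last letter of v that dominates m is maximal among these. *)
case/lastP eqf : (filter (le_box m) v) => [|s z] // Pz _; exists z.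
have : z \in filter (le_box m) v by rewrite eqf mem_rcons inE eqxx.
rewrite mem_filter => /andP[mz zv]; split=> //.
  move=> y yv zy; have : y \in filter (le_box m) v.
    by rewrite mem_filter yv andbT; move: mz zy; rewrite /le_box; lia.
  rewrite eqf mem_rcons inE => /orP[/eqP//|ys].
  by move: Pz; rewrite pairwise_rcons => /andP[/allP/(_ _ ys)]; rewrite zy.
have := linext_rcons L1 zv.
have : ~~ le_box c0 z by apply: (linext_rcons L); rewrite mem_rcons inE zv orbT.
move: mz nc0c ncc0; rewrite /le_box /between /lt_content /=; lia.
Qed.

(** Suppose that the largest entry is at c0.  By induction on the smaller shapes the
second largest can be brought to c and the third largest to a box whose content
is between; then one exchange of the two largest entries is allowed. *)
Lemma dual_equiv_move_max w c : linext w -> straight w -> c \in w ->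
  (forall y, y \in w -> le_box c y -> y = c) -> exists u, dual_equiv w (rcons u c).
Proof.
have [n] := ubnP (size w); elim: n w c => // n IH w c.
case/lastP: w => // v c0; rewrite size_rcons ltnS => sz L S.
rewrite mem_rcons inE => /orP[/eqP->|cv] cmax; first by exists v; exact: Dual_refl.
have L1 := linext_belast L; have S1 := straight_rcons L S.
have [v1 E1] : exists u, dual_equiv v (rcons u c).
  by apply: IH => // y yv; apply: cmax; rewrite mem_rcons inE yv orbT.
have E2 := dual_equiv_rcons c0 E1.
have [L2 P2] := dual_equiv_linext E2 L.
have S2 := straight_ext S (perm_mem P2).
have ncc0 : ~~ le_box c c0.
  apply/negP=> /cmax; rewrite mem_rcons inE eqxx => /(_ isT) e.
  by have := linext_rcons L cv; rewrite e le_box_refl.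
have [z [zv zmax B]] := exists_maximal_between L2 S2 ncc0.
have L3 := linext_belast (linext_belast L2).
have S3 := straight_rcons (linext_belast L2) (straight_rcons L2 S2).
have sz1 : size v1 < n.
  by apply: leq_ltn_trans sz; have /perm_size := P2; rewrite !size_rcons => -[->].
have [v2 E3] := IH v1 z sz1 L3 S3 zv zmax.
exists (rcons (rcons v2 z) c0); apply: (dual_equiv_trans E2).
apply: (dual_equiv_trans (dual_equiv_rcons c0 (dual_equiv_rcons c E3))).
have := @Dual_step v2 _ _ [::] (rcons (rcons (rcons v2 z) c0) c) (Swap_last B).
by rewrite -!cats1 -!catA /=; apply; apply: Dual_refl.
Qed.

Lemma dual_equiv_straight w w0 : linext w -> straight w -> linext w0 -> perm_eq w w0 ->
  dual_equiv w w0.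
Proof.
elim/last_ind: w0 w => [|u0 c IH] w L S L0 P.
  by move/perm_size: P => /size0nil->; exact: Dual_refl.
have cmax y : y \in w -> le_box c y -> y = c.
  rewrite (perm_mem P) mem_rcons inE => /orP[/eqP//|yu] cy.
  by have := linext_rcons L0 yu; rewrite cy.
have cw : c \in w by rewrite (perm_mem P) mem_rcons inE eqxx.
have [u E] := dual_equiv_move_max L S cw cmax.
have [Lu Pu] := dual_equiv_linext E L.
apply: (dual_equiv_trans E); apply: dual_equiv_rcons; apply: IH.
- exact: linext_belast Lu.
- exact: straight_rcons Lu (straight_ext S (perm_mem Pu)).
- exact: linext_belast L0.
- by have := P; rewrite (permPl Pu) -!cats1 perm_cat2r.
Qed.

(** * The tableau filled along antidiagonals *)

Lemma evac_commuting w : pairwise (fun x y => ~~ adj x y) w ->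
  evac w = rev w /\ corners w = rev w.
Proof.
have key x v : all (fun y => ~~ adj x y) v -> pass x v = rcons v x.
  by elim: v => //= y v IH /andP[/negbTE-> /IH->].
elim: w => //= x w IH /andP[xw /IH[-> ->]]; rewrite key ?all_rev //.
by rewrite last_rcons rev_cons.
Qed.

Definition antidiag k : seq box := [seq (i.+1, k - i) | i <- iota 0 k].

(** A linear extension of the staircase of size k for which every slide follows a
column. *)
Fixpoint antidiags k : seq box :=
  if k is k'.+1 then antidiags k' ++ antidiag k else [::].

Definition down (x : box) : box := (x.1.+1, x.2).

Lemma mem_antidiag k (x : box) :
  (x \in antidiag k) = [&& 0 < x.1, 0 < x.2 & x.1 + x.2 == k.+1].
Proof.
apply/mapP/idP => [[i]|].
  by rewrite mem_iota => ik ->; rewrite /=; lia.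
case: x => a b /= H; exists a.-1; first by rewrite mem_iota; lia.
by congr (_, _); lia.
Qed.

Lemma mem_antidiags k (x : box) :
  (x \in antidiags k) = [&& 0 < x.1, 0 < x.2 & x.1 + x.2 <= k.+1].
Proof.
elim: k => [|k IH] /=; first by rewrite in_nil; lia.
by rewrite mem_cat IH mem_antidiag; case: x {IH} => a b /=; lia.
Qed.

Lemma antidiag_pairwise k :
  pairwise (fun x y => ~~ le_box y x && ~~ adj x y) (antidiag k).
Proof.
rewrite /antidiag pairwise_map.
have: pairwise ltn (iota 0 k).
  by rewrite -sorted_pairwise; [exact: iota_ltn_sorted|exact: ltn_trans].
apply: sub_in_pairwise (allss (iota 0 k)) => i j.
rewrite !mem_iota /le_box /adj /=; lia.
Qed.

Lemma antidiags_linext k : linext (antidiags k).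
Proof.
split.
- elim: k => //= k IH; rewrite pairwise_cat IH /=; apply/andP; split.
    apply/allrelP => -[a b] [c d].
    by rewrite mem_antidiags mem_antidiag /le_box /=; lia.
  apply: sub_pairwise (antidiag_pairwise k.+1) => x y /=; by case/andP.
- by move=> [a b]; rewrite mem_antidiags /=; lia.
- by move=> [a b] [c d] [e f]; rewrite !mem_antidiags /le_box /=; lia.
Qed.

Lemma antidiags_straight k : straight (antidiags k).
Proof. by move=> [a b] [c d]; rewrite !mem_antidiags /le_box /=; lia. Qed.

Lemma antidiags_to_border k : to_border k (antidiags k).
Proof.
move=> [a b] abw; have := abw; rewrite mem_antidiags /= => /and3P[a0 b0 ab].
by split=> // lt_ab; rewrite !mem_antidiags /=; lia.
Qed.

Lemma adj_down x y : adj (down x) (down y) = adj x y.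
Proof. rewrite /adj /down /=; lia. Qed.

Lemma pass_down x v : pass (down x) (map down v) = map down (pass x v).
Proof.
by elim: v x => //= y v IH x; rewrite adj_down; case: ifP => _ /=; rewrite IH.
Qed.

Lemma evac_down w : evac (map down w) = map down (evac w).
Proof. by elim: w => //= x w ->; rewrite pass_down. Qed.

Lemma corners_down w : corners (map down w) = map down (corners w).
Proof. by elim: w => //= x w ->; rewrite evac_down pass_down last_map map_rcons. Qed.

Lemma pass_nonadj x v w : all (fun y => ~~ adj x y) v ->
  pass x (v ++ w) = v ++ pass x w.
Proof. by elim: v => //= y v IH /andP[/negbTE-> /IH->]. Qed.

(** Where the holes stand before they enter a shape with column heights ht. *)
Definition under_columns (ht : nat -> nat) K : seq box :=
  [seq ((ht j).+1, j) | j <- iota 1 K].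

(** The hole in column j only meets adjacent contents in its own column and climbs
it up to the first row, so that the columns move down by one.  In the induction
the last letter c of L passes through all the holes and is exchanged with the
one of its column. *)
Lemma sweeps_under_columns K L ht : linext L -> straight L ->
  (forall i j, ((i, j) \in L) = [&& 0 < i, 0 < j, j <= K & i <= ht j]) ->
  (sweeps L (under_columns ht K)).2 = [seq down x | x <- L].
Proof.
elim/last_ind: L ht => // L [p q] IH ht L1 S1 spec.
have L2 := linext_belast L1; have S2 := straight_rcons L1 S1.
have last_max i j : (i, j) \in rcons L (p, q) -> p <= i -> q <= j -> (i, j) = (p, q).
  rewrite mem_rcons inE => /orP[/eqP//|ijL] pi qj.
  by have := linext_rcons L1 ijL; rewrite /le_box /= pi qj.
have pqL : (p, q) \in rcons L (p, q) by rewrite mem_rcons inE eqxx.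
have := pqL; rewrite spec => /and4P[p0 q0 qK pht].
have htq : ht q = p.
  apply/eqP; rewrite eqn_leq pht andbT leqNgt; apply/negP=> p_lt.
  have := last_max p.+1 q; rewrite spec q0 qK p_lt leqnSn leqnn => /(_ isT isT isT) [].
  by lia.
(* The column heights without the last letter (p, q). *)
set ht' := fun j => if j == q then p.-1 else ht j.
have eK : iota 1 K = iota 1 q.-1 ++ q :: iota q.+1 (K - q).
  rewrite -{1}(_ : q.-1 + (K - q).+1 = K); last by lia.
  by rewrite iotaD /=; congr (_ ++ _ :: _); [|congr iota]; lia.
set A := [seq ((ht j).+1, j) : box | j <- iota 1 q.-1].
set B := [seq ((ht j).+1, j) : box | j <- iota q.+1 (K - q)].
have e1 : under_columns ht K = A ++ (p.+1, q) :: B.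
  by rewrite /under_columns eK map_cat /= htq.
have e2 : under_columns ht' K = A ++ (p, q) :: B.
  rewrite /under_columns eK map_cat /= /ht' eqxx prednK //; congr (_ ++ _ :: _).
    by apply/eq_in_map => j; rewrite mem_iota; case: eqP => // ->; lia.
  by apply/eq_in_map => j; rewrite mem_iota; case: eqP => // ->; lia.
have ep : pass (p, q) (under_columns ht K) = rcons (under_columns ht' K) (p.+1, q).
  rewrite e1 e2 pass_nonadj /=; last first.
    apply/allP => _ /mapP[j + ->]; rewrite mem_iota => jq.
    have : (p, j) \in rcons L (p, q) by apply: (S1 _ _ pqL); rewrite /le_box /=; lia.
    by rewrite spec /adj /=; lia.
  rewrite {1}/adj /=; case: ifP => [_|]; last by lia.
  rewrite -{1}(cats0 B) pass_nonadj; first by rewrite cats1 rcons_cat.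
  apply/allP => _ /mapP[j + ->]; rewrite mem_iota => jq.
  have htj : ht j < p.
    rewrite ltnNge; apply/negP => pj.
    have := last_max p j; rewrite spec p0 pj leqnn => H.
    have [] : (p, j) = (p, q) by apply: H; lia.
    by lia.
  by rewrite /adj /=; lia.
rewrite sweeps_rcons ep last_rcons map_rcons /=.
rewrite (_ : take _ _ = under_columns ht' K).
  congr rcons; apply: IH => // i j; rewrite /ht'.
  have e : ((i, j) \in L) = ((i, j) \in rcons L (p, q)) && ((i, j) != (p, q)).
    rewrite mem_rcons inE; case: eqP => [->|_] /=; last by rewrite andbT.
    by apply/negP=> /(linext_rcons L1); rewrite le_box_refl.
  by rewrite e spec -pair_eqE /=; have [->|jq] := eqVneq j q; rewrite ?htq; lia.
by rewrite -cats1 take_cat !size_map !size_iota ltnn subnn take0 cats0.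
Qed.

Lemma under_columns_antidiag k :
  under_columns (fun j => k.+1 - j) k.+1 = rev (antidiag k.+1).
Proof.
apply: (@eq_from_nth _ (0, 0)).
  by rewrite size_rev !size_map !size_iota.
rewrite !size_map size_iota => i ik.
rewrite nth_rev size_map size_iota // !(nth_map 0) ?size_iota ?nth_iota //; try lia.
by congr (_, _); lia.
Qed.

Lemma corners_antidiags k :
  corners (antidiags k.+1) =
    rev (antidiag k.+1) ++ [seq down x | x <- corners (antidiags k)].
Proof.
have /evac_commuting[e1 e2] : pairwise (fun x y => ~~ adj x y) (antidiag k.+1).
  by apply: sub_pairwise (antidiag_pairwise k.+1) => x y /= /andP[].
rewrite [antidiags _]/= corners_cat e1 e2 -under_columns_antidiag.
rewrite sweeps_under_columns ?corners_down //.
- exact: antidiags_linext.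
- exact: antidiags_straight.
- by move=> i j; rewrite mem_antidiags /=; lia.
Qed.

Lemma act_rev_antidiag k x :
  act [seq b.1 | b <- rev (antidiag k)] x =
    if x == k.+1 then 1 else if 0 < x <= k then x.+1 else x.
Proof.
have -> : [seq b.1 | b <- rev (antidiag k)] = rev (iota 1 k).
  rewrite map_rev -map_comp -[1]addn0 iotaDl; congr rev.
elim: k x => [|k IH] x; first by case: x => [|[]].
have -> : rev (iota 1 k.+1) = [:: k.+1] ++ rev (iota 1 k).
  by rewrite -{1}[k.+1]addn1 iotaD rev_cat add1n.
by rewrite act_cat IH; move: (@swap_at_spec k.+1 x); rewrite /act /=;
  do !case: ifP; lia.
Qed.

Lemma act_map_succ rs x : act [seq r.+1 | r <- rs] x.+1 = (act rs x).+1.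
Proof.
elim: rs x => //= r rs IH x; rewrite -IH; congr act.
by rewrite /swap_at !eqSS; case: eqP => // _; case: eqP.
Qed.

Lemma act_map_succ1 rs : 0 \notin rs -> act [seq r.+1 | r <- rs] 1 = 1.
Proof.
elim: rs => //= r rs IH; rewrite inE negb_or => /andP[r0 /IH].
by rewrite /act /= [swap_at _ 1]/swap_at eqSS (negbTE r0).
Qed.

Lemma corners_sub w : {subset corners w <= w}.
Proof.
elim: w => //= x w IH y; rewrite mem_rcons inE => /orP[/eqP->|/IH yw]; last first.
  by rewrite inE yw orbT.
have := mem_last x (pass x (evac w)).
rewrite inE (perm_mem (perm_pass _ _)) !inE (perm_mem (perm_evac _)).
by case/or3P => ->; rewrite ?orbT.
Qed.

Lemma act_corners_antidiags k x : 0 < x <= k.+1 ->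
  act [seq b.1 | b <- corners (antidiags k)] x = k.+2 - x.
Proof.
elim: k x => [|k IH] x; first by move=> ?; have -> : x = 1 by lia.
move=> xk; rewrite corners_antidiags map_cat act_cat act_rev_antidiag.
rewrite -map_comp (@eq_map _ _ _ (succn \o (fun b : box => b.1))) // map_comp.
case: eqP => [->|xk'].
  rewrite act_map_succ1; first by lia.
  apply/mapP => -[b /corners_sub]; rewrite mem_antidiags => /andP[b0 _] e.
  by rewrite -e in b0.
have -> : 0 < x <= k.+1 by lia.
by rewrite act_map_succ IH; lia.
Qed.

(** * How promotion of the staircase changes the corners *)

Lemma act_corners_staircase k w x : linext w -> w =i antidiags k -> 0 < x <= k.+1 ->
  act [seq b.1 | b <- corners w] x = k.+2 - x.
Proof.
move=> L e; have e' z : (z \in antidiags k) = (z \in w) by rewrite e.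
rewrite (@act_corners_dual_equiv k w (antidiags k)) //.
- exact: act_corners_antidiags.
- apply: dual_equiv_straight => //.
  + exact: straight_ext (@antidiags_straight k) e'.
  + exact: antidiags_linext.
  + by apply: uniq_perm e; apply: linext_uniq => //; exact: antidiags_linext.
- exact: to_border_ext (@antidiags_to_border k) e'.
Qed.

Definition promote (w : seq box) : seq box :=
  if w is x :: s then
    let: (g, u) := sweep (belast x s) (last x s) in g :: u
  else [::].

Lemma promote_rcons u h : promote (rcons u h) = (sweep u h).1 :: (sweep u h).2.
Proof.
rewrite /promote; case: u => //= x u.
rewrite belast_rcons last_rcons /=; case: (sweep u h) => g u2.
by case: ifP.
Qed.

Lemma perm_promote w : perm_eq (promote w) w.
Proof.
by case/lastP: w => // u h; rewrite promote_rcons perm_sweep.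
Qed.

Lemma linext_promote w : linext w -> linext (promote w).
Proof.
case/lastP: w => // u h; rewrite promote_rcons -cats1.
by move=> /(@linext_sweep [::] u h [::]); rewrite cats0.
Qed.

(** Write A for the product over the corners common to both words, r for the last
corner of the promoted word and w0 for the reversal.  Then A s_h = w0 = s_r A,
where products act from right to left, so that s_r = w0 s_h w0. *)
Lemma last_evac_promote_transpose k u h : linext (rcons u h) ->
  rcons u h =i antidiags k ->
  last h (evac (promote (rcons u h))) = (h.2, h.1).
Proof.
move=> L e; set w := rcons u h in L e *.
have Lp := linext_promote L.
have ep : promote w =i antidiags k by move=> z; rewrite (perm_mem (perm_promote w)).
have O : to_border k w.
  by apply: to_border_ext (@antidiags_to_border k) _ => z; rewrite e.
have Op : to_border k (promote w).
  by apply: to_border_ext (@antidiags_to_border k) _ => z; rewrite ep.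
have hk := to_border_last L O.
have hw : h \in antidiags k by rewrite -e mem_rcons inE eqxx.
have := fun x => @act_corners_staircase k _ x Lp ep.
have := fun x => @act_corners_staircase k _ x L e.
have := corners_on_border Lp Op.
rewrite /w corners_rcons promote_rcons /=.
set g := (sweep u h).1; set u' := (sweep u h).2; rewrite all_rcons => /andP[/eqP].
have -> : last h (pass g (evac u')) = last g (pass g (evac u')) by rewrite last_pass.
set r := last g _ => rk _.
set A := act [seq b.1 | b <- corners u'].
have Ar x : act [seq b.1 | b <- rcons (corners u') r] x = swap_at r.1 (A x).
  by rewrite map_rcons -cats1 act_cat.
move: hw; rewrite mem_antidiags => /and3P[h1 h2 _] H1 H2.
have eA : A h.1.+1 = k.+2 - h.1.
  have : A (swap_at h.1 h.1) = k.+2 - h.1 by apply: H1; lia.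
  by rewrite /swap_at eqxx.
(* s_r lowers k + 2 - h.1 by one, which determines r. *)
have H3 : swap_at r.1 (k.+2 - h.1) = k.+2 - h.1.+1 by rewrite -eA -Ar H2 //; lia.
have := @swap_at_spec r.1 (k.+2 - h.1); rewrite H3 => H4.
have r1 : r.1 = h.2 by lia.
have r2 : r.2 = h.1 by lia.
by rewrite [r]surjective_pairing r1 r2.
Qed.

(** * The word of the embedded tableau *)

Definition half_turn k (b : box) : box := (k.+2 - b.1, k.+1 - b.2).

(** A half turn exchanges the two directions in which letters travel, as it
preserves adjacency of contents. *)
Lemma sweep_rev_map (f : box -> box) (P : pred box) x v :
  {in P &, forall y z, adj (f y) (f z) = adj y z} -> all P (x :: v) ->
  sweep (rev (map f v)) (f x) =
    (f (last x (pass x v)), rev (map f (take (size v) (pass x v)))).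
Proof.
move=> H; elim: v x => //= y v IH x /and3P[Px Py Pv].
rewrite rev_cons -cats1 sweep_cat /= H //.
have adjC : adj y x = adj x y by rewrite /adj orbC.
rewrite adjC; case: ifP => _ /=; rewrite IH /= ?Px ?Py //; rewrite rev_cons cats1.
  by rewrite last_pass.
by rewrite last_pass.
Qed.

Lemma adj_half_turn k x y : x \in antidiags k -> y \in antidiags k ->
  adj (half_turn k x) (half_turn k y) = adj x y.
Proof.
rewrite !mem_antidiags /adj /half_turn /=; lia.
Qed.

Lemma half_turnK k (x : box) : x \in antidiags k -> half_turn k (half_turn k x) = x.
Proof.
by case: x => a b; rewrite mem_antidiags /half_turn /= => H; congr (_, _); lia.
Qed.

Definition rect_word k w := w ++ rev (map (half_turn k) (evac w)).

Lemma mem_rect_word k w (b : box) : w =i antidiags k ->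
  (b \in rect_word k w) = [&& 0 < b.1, b.1 <= k.+1, 0 < b.2 & b.2 <= k].
Proof.
move=> e.
have mem_ev (x : box) : (x \in evac w) = (x \in antidiags k).
  by rewrite (perm_mem (perm_evac _)) e.
rewrite mem_cat e mem_antidiags mem_rev; apply/orP/idP => [[|/mapP[x]]|bk].
- by lia.
- by rewrite mem_ev mem_antidiags => xk ->; rewrite /half_turn /=; lia.
case: (leqP (b.1 + b.2) k.+1) => bk'; [left; lia|right; apply/mapP].
exists (half_turn k b); first by rewrite mem_ev mem_antidiags /half_turn /=; lia.
by case: b bk bk' => a b /= *; rewrite /half_turn /=; congr (_, _); lia.
Qed.

Lemma pairwise_rev (r : rel box) s : pairwise r (rev s) = pairwise (fun x y => r y x) s.
Proof.
elim: s => //= x s IH; rewrite rev_cons pairwise_rcons IH all_rev.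
by rewrite andbC.
Qed.

Lemma linext_rect_word k w : linext w -> w =i antidiags k ->
  linext (rect_word k w).
Proof.
move=> L e.
have mem_ev x : (x \in evac w) = (x \in antidiags k).
  by rewrite (perm_mem (perm_evac _)) e.
split; last 2 first.
- by move=> b; rewrite mem_rect_word //; lia.
- by move=> [a b] [c d] [i j]; rewrite !mem_rect_word // /le_box /=; lia.
have [Lw _ _] := L; have [Le _ _] := @linext_evac [::] w L.
rewrite pairwise_cat Lw /=; apply/andP; split.
  apply/allrelP => x y; rewrite e mem_rev mem_antidiags => xk /mapP[z].
  by rewrite mem_ev mem_antidiags => zk ->; rewrite /le_box /=; lia.
rewrite pairwise_rev pairwise_map.
apply: sub_in_pairwise (allss _) Le => x y.
by rewrite !mem_ev !mem_antidiags /le_box /=; lia.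
Qed.

(** The half turn of (h.2, h.1) is the box directly south of h, so the hole that
leaves the lower half moves on to h, where the promotion of w starts. *)
Lemma promote_rect_word k u h : linext (rcons u h) -> rcons u h =i antidiags k ->
  promote (rect_word k (rcons u h)) = rect_word k (promote (rcons u h)).
Proof.
move=> L e; have ll := last_evac_promote_transpose L e; move: ll.
have ev : evac (rcons u h) = (sweep u h).1 :: evac (sweep u h).2 by rewrite evac_rcons.
rewrite /rect_word promote_rcons ev /= rev_cons -rcons_cat promote_rcons.
rewrite sweep_cat.
set g := (sweep u h).1; set u' := (sweep u h).2 => ll.
have ga : all (mem (antidiags k)) (g :: evac u').
  by apply/allP => z; rewrite -ev (perm_mem (perm_evac _)) /= e.
have half_turn_adj : {in mem (antidiags k) &,
    forall y z, adj (half_turn k y) (half_turn k z) = adj y z}.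
  by move=> x y; apply: adj_half_turn.
rewrite (sweep_rev_map half_turn_adj ga) /=.
rewrite -(last_pass g (evac u') h) ll -cats1 sweep_cat /=.
have hw : h \in antidiags k by rewrite -e mem_rcons inE eqxx.
have Oh : h.1 + h.2 = k.+1.
  apply: (to_border_last L).
  by apply: to_border_ext (@antidiags_to_border k) _ => z; rewrite e.
have -> : adj h (half_turn k (h.2, h.1)).
  by move: hw; rewrite mem_antidiags /adj /half_turn /=; lia.
rewrite /=; congr (_ :: _); rewrite -/u' -catA; congr (_ ++ _).
by rewrite [in RHS]pass_split map_rcons rev_rcons -(last_pass g (evac u') h) ll.
Qed.

(** * Fillings and their words *)

Definition reads (T : filling) (w : seq box) := map T w = iota 1 (size w).

Lemma reads_index T w b : reads T w -> b \in w -> T b = (index b w).+1.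
Proof.
move=> Tw bw; have ib : index b w < size w by rewrite index_mem.
by rewrite -{1}(nth_index b bw) -(nth_map b 0 T ib) Tw nth_iota.
Qed.

Lemma pos_of_last T D u b : reads T (rcons u b) -> D =i rcons u b ->
  pos_of T D (size u).+1 = b.
Proof.
move=> Tw eD; rewrite /pos_of.
have bD : b \in D by rewrite eD mem_rcons inE eqxx.
have hasb : has (fun x => T x == (size u).+1) D.
  apply/hasP; exists b => //; move: Tw; rewrite /reads map_rcons size_rcons.
  by rewrite -[(size u).+1]addn1 iotaD cats1 add1n => /rcons_inj[_ ->]; rewrite addn1.
have /eqP := nth_find (0, 0) hasb; set x := nth _ _ _ => Tx.
have xw : x \in rcons u b by rewrite -eD mem_nth // -has_find.
have := reads_index Tw xw; rewrite Tx => -[ix].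
by have := nth_index b xw; rewrite -ix nth_rcons ltnn eqxx.
Qed.

(** An adjacent letter just before b must lie below b in the order of boxes, and no
box fits between them. *)
Lemma adj_before p c b q : linext (p ++ c :: b :: q) -> adj c b ->
  c = north b \/ c = west b.
Proof.
move=> L cb; have [_ pos _] := L.
have /andP[b1 b2] : (0 < b.1) && (0 < b.2).
  by apply: pos; rewrite mem_cat !inE eqxx !orbT.
have nbc : ~~ le_box b c by have [/(_ (mem_head _ _))] := linext_before b L.
have cover z : le_box c z -> le_box z b -> z = c \/ z = b by apply: consecutive L.
case: b c cb b1 b2 nbc cover {pos L} => [i j] [a d].
rewrite /adj /le_box /north /west /=.
move=> cb b1 b2 nbc cover.
have := cover (i.-1, j); have := cover (i, j.-1); rewrite /le_box /=.
have [dj|jd] := leqP d j; have [ai|ia] := leqP a i; try lia.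
case/orP: cb => /eqP e.
  move=> _ [||[-> ->]|[]]; auto; lia.
by move=> [||[-> ->]|[]]; auto; lia.
Qed.

(** The letters of p carry the entries not yet compared with the hole b, those of q
the larger ones.  The next letter c either is not adjacent and is skipped
without a move, or it is the larger of the entries north and west of b, because
the other one, if present, comes earlier in the word. *)
Lemma slide_rec_sweep n T D p b q : linext (p ++ b :: q) -> D =i p ++ b :: q ->
  b.1 + b.2 <= n ->
  map T p = iota 1 (size p) -> map T q = iota (size p).+1 (size q) ->
  exists T', slide_rec n T D b = (T', (sweep p b).1) /\
    map T' ((sweep p b).2 ++ q) = iota 1 (size p + size q).
Proof.
elim/last_ind: p n T b q => [|p c IH] n T b q L eD bn Tp Tq.
  exists T; split; last by rewrite /= add0n.
  case: n bn => // n bn; rewrite /= /slide_source.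
  have [_ pos _] := L; have /andP[b1 b2] := pos b (mem_head _ _).
  have nD z : le_box z b -> z != b -> (z \in D) = false.
    move=> zb nzb; rewrite eD inE (negbTE nzb) /=; apply/negP=> zq.
    by have [/(_ zq)] := @linext_before [::] b q z L; rewrite zb.
  by rewrite !nD // /north /west /le_box -?pair_eqE /=; lia.
move: Tp; rewrite map_rcons size_rcons -[(size p).+1]addn1 iotaD cats1 add1n.
move=> /rcons_inj[Tp Tc].
rewrite cat_rcons in L eD; rewrite size_rcons in Tq.
have Tlt z : z \in p -> T z < T c.
  by move=> /(map_f T); rewrite Tp Tc mem_iota; lia.
have sw : sweep (rcons p c) b =
    if adj c b then ((sweep p c).1, rcons (sweep p c).2 b)
    else ((sweep p b).1, rcons (sweep p b).2 c).
  by rewrite -cats1 sweep_cat /=; case: ifP => _ /=; rewrite cats1.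
rewrite sw; case: ifP => cb /=.
  have [_ pos _] := L.
  have /andP[b1 b2] : (0 < b.1) && (0 < b.2).
    by apply: pos; rewrite mem_cat !inE eqxx !orbT.
  have Lq : linext (rcons p c ++ b :: q) by rewrite cat_rcons.
  have inp z : z \in D -> le_box z b -> z != b -> z != c -> z \in p.
    rewrite eD mem_cat !inE => + zb /negbTE nzb /negbTE nzc; rewrite nzb nzc /=.
    by case/orP => // zq; have [/(_ zq)] := linext_before z Lq; rewrite zb.
  have cD : c \in D by rewrite eD mem_cat !inE eqxx orbT.
  case: n bn => [|n] bn; first by lia.
  have src : slide_source T D b = Some c.
    rewrite /slide_source; have [ec|ec] := adj_before L cb.
      rewrite -ec cD; case: ifP => // /inp wp; rewrite Tlt //; apply: wp;
        by rewrite ?ec /le_box -?pair_eqE /=; lia.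
    rewrite -ec cD; case: ifP => // /inp np; rewrite ltnNge ltnW //.
    apply: Tlt; apply: np;
        by rewrite ?ec /le_box -?pair_eqE /=; lia.
  rewrite /= src.
  have Lu := linext_uniq L.
  have [bp [bc bq]] : b \notin p /\ b \notin q /\ c \notin q.
    move: Lu; rewrite cat_uniq /= !inE !negb_or => /and3P[_ /and3P[_ -> _]].
    by move=> /and3P[/andP[_ ->] -> _].
  set T1 := fun x => if x == b then T c else T x.
  have agree s : b \notin s -> map T1 s = map T s.
    move=> bs; apply/eq_in_map => x xs; rewrite /T1; case: eqP => // e.
    by rewrite -e xs in bs.
  have [T' [e1 e2]] : exists T', slide_rec n T1 D c = (T', (sweep p c).1) /\
    map T' ((sweep p c).2 ++ b :: q) = iota 1 (size p + size (b :: q)).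
    apply: IH => //.
    - have [->|->] := adj_before L cb; rewrite /north /west /=; lia.
    - by rewrite agree.
    - by rewrite /= agree // Tq /T1 eqxx Tc.
  by exists T'; rewrite e1 cat_rcons e2 /= addn1 addSnnS.
have [T' [e1 e2]] : exists T', slide_rec n T D b = (T', (sweep p b).1) /\
    map T' ((sweep p b).2 ++ c :: q) = iota 1 (size p + size (c :: q)).
  apply: IH => //.
  - by apply: linext_swap; rewrite ?cb.
  - by move=> z; rewrite eD !mem_cat !inE; congr (_ || _); rewrite orbCA.
  - by rewrite /= Tq Tc.
by exists T'; rewrite e1 cat_rcons e2 /= addn1 addSnnS.
Qed.

Lemma slide_sweep T D u b : linext (rcons u b) -> D =i rcons u b ->
  reads T (rcons u b) ->
  exists T', slide T D b = (T', (sweep u b).1) /\ reads T' (sweep u b).2.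
Proof.
move=> L eD; rewrite /reads map_rcons size_rcons -[(size u).+1]addn1 iotaD cats1.
move=> /rcons_inj[Tu _].
have L' : linext (u ++ [:: b]) by rewrite cats1.
have eD' : D =i u ++ [:: b] by move=> z; rewrite eD cats1.
have [T' [e1 e2]] := slide_rec_sweep L' eD' (leqnn _) Tu erefl.
exists T'; split=> //.
by move: e2; rewrite cats0 addn0 /reads size_sweep.
Qed.

Lemma promotion_reads la T w : linext w -> boxes la =i w -> size w = sumn la ->
  reads T w -> reads (promotion la T) (promote w).
Proof.
case/lastP: w => // u b L eD sz Tw.
rewrite /reads promote_rcons /= size_sweep /promotion -sz size_rcons (pos_of_last Tw eD).
have [T' [-> T'u]] := slide_sweep L eD Tw; rewrite eqxx; congr (_ :: _).
have : uniq ((sweep u b).1 :: (sweep u b).2).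
  by rewrite (perm_uniq (perm_sweep u b)) linext_uniq.
rewrite /= => /andP[hu _].
rewrite -[2]/(1 + 1) iotaDl -(size_sweep u b) -T'u -map_comp.
apply/eq_in_map => x xu /=; case: eqP => // e.
by rewrite -e xu in hu.
Qed.

Lemma evac_slide_reads T D u b : linext (rcons u b) -> D =i rcons u b ->
  reads T (rcons u b) ->
  exists T', evac_slide (T, D) = (T', (sweep u b).1) /\ reads T' (sweep u b).2.
Proof.
move=> L eD Tw; rewrite /evac_slide /=.
suff -> : \max_(x <- D) T x = (size u).+1.
  by rewrite (pos_of_last Tw eD); exact: slide_sweep.
apply/eqP; rewrite eqn_leq; apply/andP; split.
  apply/bigmax_leqP_seq => x; rewrite eD => xw _.
  by rewrite (reads_index Tw xw) -(size_rcons u b) index_mem.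
have bw : b \in rcons u b by rewrite mem_rcons inE eqxx.
have : T b = (size u).+1.
  have := Tw; rewrite /reads map_rcons size_rcons -[(size u).+1]addn1 iotaD cats1.
  by move=> /rcons_inj[_]; rewrite add1n addn1.
by move=> <-; apply: leq_bigmax_seq; rewrite ?eD.
Qed.

Lemma evac_boxes T D w : linext w -> D =i w -> reads T w ->
  [seq (evac_slide (iter k evac_step (T, D))).2 | k <- iota 0 (size w)] = evac w.
Proof.
have [n] := ubnP (size w); elim: n w T D => // n IH w T D.
case/lastP: w => // u b; rewrite size_rcons ltnS => sz L eD Tw.
have [T' [e1 T'u]] := evac_slide_reads L eD Tw.
rewrite evac_rcons /= e1 /= -[1]addn0 iotaDl -map_comp; congr (_ :: _).
rewrite -(size_sweep u b) -(IH _ T' [seq x <- D | x != (sweep u b).1]) ?size_sweep //.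
- apply: eq_map => j.
  rewrite -[LHS]/(evac_slide (iter j.+1 evac_step (T, D))).2 iterSr.
  by rewrite {2}/evac_step e1.
- exact: linext_sweep_behead.
have : uniq ((sweep u b).1 :: (sweep u b).2).
  by rewrite (perm_uniq (perm_sweep u b)) linext_uniq.
rewrite /= => /andP[hu _] z.
rewrite mem_filter eD -(perm_mem (perm_sweep u b)) inE.
by case: eqP => [->|_] //=; rewrite (negbTE hu).
Qed.

Lemma evacuationE la T w b : linext w -> boxes la =i w -> size w = sumn la ->
  reads T w -> evacuation la T b = (index b (evac w)).+1.
Proof. by move=> L e sz Tw; rewrite /evacuation -sz -(evac_boxes L e Tw). Qed.

Lemma mem_boxes la (b : box) :
  (b \in boxes la) = [&& 0 < b.1, b.1 <= size la, 0 < b.2 & b.2 <= nth 0 la b.1.-1].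
Proof.
apply/allpairsPdep/idP => [[i [j []]]|].
  by rewrite !mem_iota => ila jla -> /=; lia.
case: b => i j /= H; exists i.-1, j.-1; rewrite !mem_iota; split; [lia|lia|].
by congr (_, _); lia.
Qed.

Lemma size_boxes la : size (boxes la) = sumn la.
Proof.
rewrite size_allpairs_dep (eq_map (g := nth 0 la)); last by move=> i; rewrite size_iota.
by rewrite -[RHS](congr1 sumn (mkseq_nth 0 la)).
Qed.

Lemma boxes_staircase k : boxes (staircase k) =i antidiags k.
Proof.
move=> [i j]; rewrite mem_boxes mem_antidiags /staircase size_rev size_iota /=.
case: (boolP (0 < i <= k)) => ik; last by lia.
by rewrite nth_rev size_iota ?nth_iota; lia.
Qed.

Lemma mem_boxes_rect k (b : box) :
  (b \in boxes (rect k k.+1)) = [&& 0 < b.1, b.1 <= k.+1, 0 < b.2 & b.2 <= k].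
Proof.
rewrite mem_boxes /rect size_nseq nth_nseq.
by case: ifP; lia.
Qed.

Lemma size_antidiags k : (size (antidiags k)).*2 = k * k.+1.
Proof.
elim: k => //= k IH; rewrite size_cat doubleD IH size_map size_iota; lia.
Qed.

Lemma syt_mono k S x y : is_syt (staircase k) S -> x \in boxes (staircase k) ->
  y \in boxes (staircase k) -> le_box x y -> S x <= S y.
Proof.
case=> _ right down; have [n] := ubnP ((y.1 - x.1) + (y.2 - x.2)).
elim: n y => // n IH [c d]; case: x IH => a b IH /=.
rewrite ltnS /le_box /= => dn xk yk /andP[ac bd].
have [a_c|ca] := ltnP a c.
  have ck : (c.-1, d) \in boxes (staircase k).
    by move: xk yk; rewrite !boxes_staircase !mem_antidiags /=; lia.
  apply: (@leq_trans (S (c.-1, d))).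
    by apply: IH; rewrite /le_box //=; lia.
  by have := down c.-1 d ck; rewrite prednK; [move=> /(_ yk)/ltnW|lia].
have [b_d|db] := ltnP b d.
  have dk : (c, d.-1) \in boxes (staircase k).
    by move: xk yk; rewrite !boxes_staircase !mem_antidiags /=; lia.
  apply: (@leq_trans (S (c, d.-1))).
    by apply: IH; rewrite /le_box //=; lia.
  by have := right c d.-1 dk; rewrite prednK; [move=> /(_ yk)/ltnW|lia].
by have [-> ->] : a = c /\ b = d by lia.
Qed.

Lemma syt_word k S : is_syt (staircase k) S ->
  exists w, [/\ linext w, w =i antidiags k & reads S w].
Proof.
move=> hS; have [P _ _] := hS.
pose w := sort (relpre S leq) (boxes (staircase k)).
have ew : w =i antidiags k by move=> z; rewrite mem_sort boxes_staircase.
have Sw : reads S w.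
  rewrite /reads -sort_map size_sort size_boxes.
  apply: (sorted_eq leq_trans anti_leq); first exact: sort_sorted leq_total _.
    exact: iota_sorted.
  by rewrite perm_sort.
exists w; split=> //; have [_ pos cvx] := antidiags_linext k; split.
- have : pairwise ltn (map S w).
    by rewrite Sw -sorted_pairwise; [exact: iota_ltn_sorted|exact: ltn_trans].
  rewrite pairwise_map; apply: sub_in_pairwise (allss w) => x y xw yw /= xy.
  rewrite !(=^~ boxes_staircase, ew) in xw yw.
  by apply/negP=> /(syt_mono hS yw xw); rewrite leqNgt xy.
- by move=> x; rewrite ew; apply: pos.
- by move=> x y z; rewrite !ew; apply: cvx.
Qed.

Lemma size_word k w : linext w -> w =i antidiags k ->
  (size w).*2 = k * k.+1 /\ size w = sumn (staircase k).
Proof.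
move=> L e; have /perm_size -> : perm_eq w (antidiags k).
  by apply: uniq_perm e; apply: linext_uniq => //; exact: antidiags_linext.
have H := size_antidiags k; split=> //.
apply: double_inj; rewrite H.
rewrite /staircase sumn_rev.
elim: k {e H} => // k IH.
have -> : iota 1 k.+1 = iota 1 k ++ [:: k.+1].
  by have := iotaD 1 k 1; rewrite addn1 add1n.
by rewrite sumn_cat doubleD -IH /=; lia.
Qed.

Lemma embedding_reads k S w : linext w -> w =i antidiags k -> reads S w ->
  reads (embedding k S) (rect_word k w).
Proof.
move=> L e Sw; have [sz2 szk] := size_word L e.
have mem_ev (x : box) : (x \in evac w) = (x \in antidiags k).
  by rewrite (perm_mem (perm_evac _)) e.
have bw : boxes (staircase k) =i w by move=> z; rewrite boxes_staircase e.
rewrite /reads /rect_word size_cat size_rev size_map size_evac iotaD map_cat.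
congr (_ ++ _).
  rewrite -Sw; apply/eq_in_map => b; rewrite e mem_antidiags /embedding.
  by case: ifP => //; lia.
(* Half of the k * k.+1 boxes are letters of w, so that the complemented entries
   of the lower half are the remaining ones. *)
rewrite map_rev -map_comp.
have -> : [seq (embedding k S \o half_turn k) i | i <- evac w] =
          [seq k * k.+1 - i | i <- iota 0 (size w)].
  apply: (@eq_from_nth _ 0); first by rewrite !size_map size_iota size_evac.
  rewrite size_map size_evac => i iw.
  rewrite (nth_map (0, 0)) ?size_evac // (nth_map 0) ?size_iota // nth_iota //.
  set x := nth _ _ _; have xe : x \in evac w by rewrite mem_nth ?size_evac.
  have xk := xe; rewrite mem_ev mem_antidiags in xk.
  rewrite /= /embedding -[(k.+2 - _, _)]/(half_turn k (half_turn k x)).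
  rewrite half_turnK -?mem_ev //; case: ifP => [|_].
    by move: xk; case: (x) => a b; rewrite /half_turn /=; lia.
  rewrite (evacuationE _ L bw szk Sw) /x index_uniq ?size_evac //.
  by rewrite (perm_uniq (perm_evac w)) linext_uniq.
apply: (@eq_from_nth _ 0); first by rewrite size_rev size_map !size_iota.
rewrite size_rev size_map size_iota => i iw.
rewrite nth_rev size_map size_iota // (nth_map 0) ?size_iota ?nth_iota //; lia.
Qed.

Theorem theorem3p6 (k : nat) (hk : 2 < k) (S : filling)
    (hS : is_syt (staircase k) S) :
  forall b : box, b \in boxes (rect k k.+1) ->
    embedding k (promotion (staircase k) S) b
      = promotion (rect k k.+1) (embedding k S) b.
Proof.
have [w [L ew Sw]] := syt_word hS.
have [sz2 szk] := size_word L ew.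
have bw : boxes (staircase k) =i w by move=> z; rewrite boxes_staircase ew.
have ep : promote w =i antidiags k by move=> z; rewrite (perm_mem (perm_promote w)).
have Lp := linext_promote L.
have lhs := embedding_reads Lp ep (promotion_reads L bw szk Sw).
have br : boxes (rect k k.+1) =i rect_word k w.
  by move=> b; rewrite mem_boxes_rect mem_rect_word.
have rhs : reads (promotion (rect k k.+1) (embedding k S)) (promote (rect_word k w)).
  apply: promotion_reads => //.
  - exact: linext_rect_word.
  - rewrite /rect_word size_cat size_rev size_map size_evac addnn sz2 /rect.
    by rewrite sumn_nseq mulnC.
  - exact: embedding_reads.
have ew2 : promote (rect_word k w) = rect_word k (promote w).
  case/lastP: w {Sw sz2 szk bw ep Lp lhs br rhs} L ew => [|u h] L ew.
    by have := ew (1, 1); rewrite mem_antidiags in_nil /= ltnS (ltn_trans _ hk).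
  exact: promote_rect_word.
rewrite ew2 in rhs.
move=> b; rewrite mem_boxes_rect -(mem_rect_word _ ep); move: b; apply/eq_in_map.
by rewrite lhs rhs.
Qed.
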